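(* Let $m\le n$, $A\subset\mathbb{R}^n$, and suppose that there exist $y\in A$, $\rho_1>0$, $G_y\in G(n,m)$ and a Lipschitz function $u:G_y\to G_y^{\perp}$ such that, with $U:=\operatorname{graph}(u)=\{x+u(x):x\in G_y\}\subset\mathbb{R}^n$, $$\Theta^m_*(A,\mathcal H^m,y)=\infty,\qquad y\in U,\qquad\text{and}\qquad \overline{B_{\rho_1}(y)\cap A\cap U}=U\cap\overline{B_{\rho_1}(y)}.$$ Then $A\notin R(w,\rho,\delta;m)$.
   Context: $B_r(x)$ is the open ball in $\mathbb{R}^n$, $\overline{S}$ is the closure of $S$, and $L^r=\{x\in\mathbb{R}^n:d(x,L)<r\}$. $G(n,m)$ is the set of $m$-dimensional linear subspaces of $\mathbb{R}^n$, $G_x(n,m)=\{G+x:G\in G(n,m)\}$, and $G_y^\perp$ is the orthogonal complement of $G_y$. $\mathcal H^m$ is $m$-dimensional Hausdorff measure. The lower $m$-dimensional density of $A$ at $y$ is $\Theta^m_*(A,\mathcal H^m,y)=\liminf_{\rho\to0}\frac{\mathcal H^m(A\cap B_\rho(y))}{\omega_m\rho^m}$, where $\omega_m$ is the $\mathcal H^m$ measure of the unit $m$-ball. $A\in R(w,\rho,\delta;m)$ means: for every $\gamma\in(0,1)$ and every $y\in A$ there is $\rho_y>0$ (which may depend on $\gamma$) such that for all $\rho\in(0,\rho_y]$ and all $x\in B_{\rho_y}(y)\cap A$ there is $L_{x,\rho}\in G_x(n,m)$ with $B_\rho(x)\cap A\subset L_{x,\rho}^{\gamma\rho}$. *)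

(* Defs.v *)
From HB Require Import structures.
From mathcomp Require Import all_boot all_order all_algebra.
From mathcomp Require Import all_classical all_reals all_analysis.

Set Implicit Arguments.
Unset Strict Implicit.
Unset Printing Implicit Defensive.

Import Order.TTheory GRing.Theory Num.Theory.
Import numFieldNormedType.Exports.

Local Open Scope classical_set_scope.
Local Open Scope ring_scope.

(* R^n is 'rV[R]_n. The norm MathComp-Analysis puts on this type is the sup
   norm, hence the Euclidean norm and balls below; the two norms induce the
   same topology, so [closure] is the usual closure in R^n. *)

Definition dot (R : realType) (n : nat) (u v : 'rV[R]_n) : R :=
  (u *m v^T) 0 0.

Definition enorm (R : realType) (n : nat) (u : 'rV[R]_n) : R :=
  Num.sqrt (dot u u).

Definition eball (R : realType) (n : nat) (x : 'rV[R]_n) (r : R) :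
    set 'rV[R]_n :=
  [set z | enorm (z - x) < r].

Definition edistance (R : realType) (n : nat) (z : 'rV[R]_n)
    (L : set 'rV[R]_n) : R :=
  inf [set enorm (z - l) | l in L].

Definition tube (R : realType) (n : nat) (L : set 'rV[R]_n) (r : R) :
    set 'rV[R]_n :=
  [set z | edistance z L < r].

Definition grassmannian (R : realType) (n m : nat) : set {vspace 'rV[R]_n} :=
  [set G | \dim G = m].

Definition affine_grassmannian (R : realType) (n m : nat) (x : 'rV[R]_n) :
    set (set 'rV[R]_n) :=
  [set [set g + x | g in [set g | g \in G]] | G in @grassmannian R n m].

Definition orthocompl (R : realType) (n : nat) (G : {vspace 'rV[R]_n}) :
    set 'rV[R]_n :=
  [set v | forall g, g \in G -> dot g v = 0].

(* A Lipschitz map G -> G^perp is a total map on R^n constrained only on G: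
   neither of the next two definitions looks at values of u outside G. *)
Definition lipschitz_to_perp (R : realType) (n : nat) (G : {vspace 'rV[R]_n})
    (u : 'rV[R]_n -> 'rV[R]_n) : Prop :=
  (forall x, x \in G -> orthocompl G (u x)) /\
  exists K : R, forall x x', x \in G -> x' \in G ->
    enorm (u x - u x') <= K * enorm (x - x').

Definition graph_over (R : realType) (n : nat) (G : {vspace 'rV[R]_n})
    (u : 'rV[R]_n -> 'rV[R]_n) : set 'rV[R]_n :=
  [set x + u x | x in [set x | x \in G]].

(* -oo on the empty set, +oo on unbounded sets *)
Definition ediam (R : realType) (n : nat) (C : set 'rV[R]_n) : \bar R :=
  ereal_sup [set (enorm (x - y))%:E | x in C & y in C].

(* diam(C)^m, with the conventions diam(set0)^m = 0 and 0^0 = 1, so that the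
   0-dimensional Hausdorff measure is the counting measure *)
Definition diam_pow (R : realType) (n m : nat) (C : set 'rV[R]_n) : \bar R :=
  if C == set0 then 0%E else (ediam C ^+ m)%E.

(* Lebesgue measure pi^(m/2) / Gamma(m/2 + 1) of the unit ball of R^m, through
   the recursion V_(m+2) = 2 pi / (m+2) V_m *)
Fixpoint unit_ball_volume (R : realType) (m : nat) : R :=
  match m with
  | 0 => 1
  | 1 => 2
  | k.+2 => 2 * pi / k.+2%:R * unit_ball_volume R k
  end.

Definition hausdorff_pre (R : realType) (n m : nat) (d : R)
    (A : set 'rV[R]_n) : \bar R :=
  ((unit_ball_volume R m / 2 ^+ m)%:E *
   ereal_inf [set \sum_(0 <= i <oo) diam_pow m (C i) |
     C in [set C : nat -> set 'rV[R]_n |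
       A `<=` \bigcup_i C i /\ forall i, (ediam (C i) < d%:E)%E]])%E.

Definition hausdorff_measure (R : realType) (n m : nat) (A : set 'rV[R]_n) :
    \bar R :=
  ereal_sup [set hausdorff_pre m d A | d in [set d : R | 0 < d]].

Definition omega (R : realType) (m : nat) : \bar R :=
  hausdorff_measure m (eball (0 : 'rV[R]_m) 1).

Definition lower_density (R : realType) (n m : nat) (A : set 'rV[R]_n)
    (y : 'rV[R]_n) : \bar R :=
  limf_einf (fun rho : R =>
    (hausdorff_measure m (A `&` eball y rho) /
     (omega R m * (rho ^+ m)%:E))%E) (0 : R)^'+.

(* The class R(w, rho, delta; m); here w, rho, delta are part of the name, not
   parameters. *)
Definition R_w_rho_delta (R : realType) (n m : nat) : set (set 'rV[R]_n) :=
  [set A | forall gamma : R, 0 < gamma -> gamma < 1 ->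
    forall y, A y -> exists2 rho_y : R, 0 < rho_y &
      forall rho : R, 0 < rho -> rho <= rho_y ->
      forall x, (eball y rho_y `&` A) x ->
      exists2 L, affine_grassmannian m x L &
        eball x rho `&` A `<=` tube L (gamma * rho)].

(* Main.v *)
Require Import Defs.
From HB Require Import structures.
From mathcomp Require Import all_boot all_order all_algebra.
From mathcomp Require Import all_classical all_reals all_analysis.
From mathcomp Require Import finmap ring lra zify.

Import Order.TTheory GRing.Theory Num.Theory.
Import numFieldNormedType.Exports.

Local Open Scope classical_set_scope.
Local Open Scope ring_scope.

(** The density hypothesis contradicts flatness because flatness forces [A] to
    lie on the Lipschitz graph [U] near [y], and subsets of a Lipschitz graph
    have finite density.

    Parametrize [U] by coordinates on [G]: [phi t = t B + u (t B)] is Lipschitz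
    on R^m and has a linear left inverse, multiplication by a matrix [Q] that
    kills [G^perp] ([graph_chart]).

    Suppose [z] in [A] is close to [y] but not on [U]. Let [phi t] be the point
    of [U] with the same [G]-coordinates and [d = |z - phi t| > 0]. Points of
    [A] lie arbitrarily close to [phi t] and to each [phi (t + d e_i)]. Apply
    flatness with a small [gamma] at a point of [A] near [phi t], at a scale
    comparable to [d]: the linear direction [V] of the plane nearly contains
    the [m] vectors [phi (t + d e_i) - phi t], whose images under [Q] are the
    [d e_i], and nearly contains [z - phi t], whose image under [Q] is [0].
    The former vectors already account for the dimension [m] of [V], so a
    vector of [V] is controlled by its image under [Q], and [z - phi t] would
    have to be much shorter than [d] ([transversal_plane_bound],
    [flat_set_in_graph]).

    Hence for small [rho] the set [A `&` eball y rho] lies in the image under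
    [phi] of a cube of size comparable to [rho], and cutting that cube into
    small cubes bounds its Hausdorff measure by a multiple of [rho ^+ m]
    ([hausdorff_measure_lipschitz_le]). The density quotient is then bounded as
    soon as the normalization [omega] is positive. That is a volume lower bound
    for covers of a cube of R^m, obtained by compactness and by counting grid
    points ([cube_finite_cover], [omega_gt0]).

    Estimates are carried out in the sup norm [`|x|], which is within a factor
    [n.+1] of [enorm x]; only constants are affected. *)

Set Implicit Arguments.
Unset Strict Implicit.

(** * Sup norm and Euclidean norm *)

Lemma normr_coord (R : realType) p q (M : 'M[R]_(p, q)) i j :
  `|M i j| <= `|M|.
Proof.
rewrite [leRHS]/Num.Def.normr /= mx_normrE; apply/bigmax_geP; right => /=.
by exists (i, j).
Qed.

Lemma mx_normr_le (R : realType) p q (M : 'M[R]_(p, q)) (c : R) :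
  0 <= c -> (forall i j, `|M i j| <= c) -> `|M| <= c.
Proof.
move=> c0 Mc; rewrite [leLHS]/Num.Def.normr /= mx_normrE.
by apply/bigmax_leP; split => // -[i j] _ /=; exact: Mc.
Qed.

Lemma normr_mulmx (R : realType) p q r (M : 'M[R]_(p, q)) (N : 'M[R]_(q, r)) :
  `|M *m N| <= q%:R * `|M| * `|N|.
Proof.
apply: mx_normr_le => [|i j]; first by rewrite !mulr_ge0.
rewrite mxE (le_trans (ler_norm_sum _ _ _))//.
rewrite -mulrA mulr_natl -[X in _ *+ X]card_ord -sumr_const.
by apply: ler_sum => k _; rewrite normrM ler_pM // normr_coord.
Qed.

Lemma enorm_ge0 (R : realType) n (x : 'rV[R]_n) : 0 <= enorm x.
Proof. exact: sqrtr_ge0. Qed.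

Lemma dotE (R : realType) n (x : 'rV[R]_n) : dot x x = \sum_j x 0 j ^+ 2.
Proof. by rewrite /dot mxE; apply: eq_bigr => j _; rewrite mxE expr2. Qed.

Lemma normr_le_enorm (R : realType) n (x : 'rV[R]_n) : `|x| <= enorm x.
Proof.
apply: mx_normr_le => [|i j]; first exact: enorm_ge0.
rewrite ord1 -sqrtr_sqr ler_wsqrtr // dotE (bigD1 j) //= lerDl.
by apply: sumr_ge0 => k _; exact: sqr_ge0.
Qed.

Lemma enorm_le_normr (R : realType) n (x : 'rV[R]_n) :
  enorm x <= n.+1%:R * `|x|.
Proof.
rewrite -[leRHS]ger0_norm ?mulr_ge0 // -sqrtr_sqr ler_wsqrtr // dotE.
apply: (@le_trans _ _ (\sum_(j < n) `|x| ^+ 2)).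
  apply: ler_sum => j _; rewrite -(real_normK (num_real (x 0 j))).
  by rewrite lerXn2r ?nnegrE // normr_coord.
rewrite sumr_const card_ord -[leLHS]mulr_natl exprMn ler_wpM2r ?exprn_ge0 //.
rewrite -natrX ler_nat; apply: leq_trans (leqnSn n) _.
by rewrite -{1}[n.+1]muln1 leq_mul.
Qed.

(** * Upper bounds for Hausdorff measure *)

Lemma ediam_ge0 (R : realType) n (C : set 'rV[R]_n) :
  C !=set0 -> (0 <= ediam C)%E.
Proof.
move=> [x Cx]; apply: ereal_sup_ubound; exists x => //; exists x => //.
by rewrite subrr /enorm dotE big1 ?sqrtr0 // => j _; rewrite mxE expr0n.
Qed.

Lemma diam_pow_ge0 (R : realType) n m (C : set 'rV[R]_n) :
  (0 <= diam_pow m C)%E.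
Proof.
rewrite /diam_pow; case: ifPn => // /set0P C0.
by rewrite expe_ge0 // ediam_ge0.
Qed.

Lemma ediam_le (R : realType) n (C : set 'rV[R]_n) (D : R) :
  (forall x y, C x -> C y -> enorm (x - y) <= D) -> (ediam C <= D%:E)%E.
Proof.
by move=> CD; apply: ge_ereal_sup => _ [x Cx [z Cz <-]]; rewrite lee_fin CD.
Qed.

Lemma diam_pow_le (R : realType) n m (C : set 'rV[R]_n) (D : R) : 0 <= D ->
  (forall x y, C x -> C y -> enorm (x - y) <= D) ->
  (diam_pow m C <= (D ^+ m)%:E)%E.
Proof.
move=> D0 CD; rewrite /diam_pow; case: ifPn => [_|/set0P C0].
  by rewrite lee_fin exprn_ge0.
have := ediam_ge0 C0; have := ediam_le CD.
case: (ediam C) => [r||] //; rewrite !lee_fin => rD r0.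
by rewrite -EFin_expe lee_fin lerXn2r.
Qed.

Lemma unit_ball_volume_gt0 (R : realType) m : 0 < unit_ball_volume R m.
Proof.
suff: 0 < unit_ball_volume R m /\ 0 < unit_ball_volume R m.+1 by case.
elim: m => [|m [IH1 IH2]] //=; split => //.
by rewrite mulr_gt0 // divr_gt0 // mulr_gt0 // pi_gt0.
Qed.

Definition hausdorff_const (R : realType) (m : nat) : R :=
  unit_ball_volume R m / 2 ^+ m.

Lemma hausdorff_const_gt0 (R : realType) m : 0 < hausdorff_const R m.
Proof. by rewrite divr_gt0 ?exprn_gt0 // unit_ball_volume_gt0. Qed.

(** A finite cover is turned into a sequence by padding with empty sets, which
    contribute nothing since [diam_pow m set0 = 0] even for [m = 0]. *)
Lemma hausdorff_pre_finite_cover (R : realType) n m (T : finType)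
    (S : set 'rV[R]_n) (P : T -> set 'rV[R]_n) (D d : R) :
  0 <= D -> D < d -> (forall x, S x -> exists t, P t x) ->
  (forall t x y, P t x -> P t y -> enorm (x - y) <= D) ->
  (hausdorff_pre m d S <= (hausdorff_const R m * (#|T|%:R * D ^+ m))%:E)%E.
Proof.
move=> D0 Dd SP PD; rewrite EFinM.
apply: lee_wpmul2l; first by rewrite lee_fin ltW // hausdorff_const_gt0.
pose C i := if insub i : option 'I_#|T| is Some k then P (enum_val k) else set0.
have CD i x z : C i x -> C i z -> enorm (x - z) <= D.
  by rewrite /C; case: insub => // k; exact: PD.
apply: (@le_trans _ _ (\sum_(0 <= i <oo) diam_pow m (C i))%E).
  apply: ereal_inf_lbound; exists C => //; split.
    move=> x /SP[t Ptx]; exists (enum_rank t : nat) => //.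
    rewrite /C; case: insubP => [k _ kE|]; last by rewrite ltn_ord.
    by rewrite (_ : k = enum_rank t) ?enum_rankK //; exact: val_inj.
  move=> i; apply: (le_lt_trans (ediam_le (CD i))); by rewrite lte_fin.
rewrite (nneseries_split 0 #|T|); last by move=> *; exact: diam_pow_ge0.
rewrite [X in (_ + X)%E]eseries0 ?adde0; last first.
  move=> i; rewrite /= add0n => Ti _; rewrite /C insubF ?/diam_pow ?eqxx //.
  by rewrite ltnNge Ti.
rewrite add0n; apply: (@le_trans _ _ (\sum_(0 <= i < #|T|) (D ^+ m)%:E)%E).
  apply: lee_sum => i _; apply: diam_pow_le => // x z; exact: CD.
by rewrite sumEFin sumr_const_nat subn0 lee_fin -[leLHS]mulr_natl.
Qed.

Lemma subdivision_cell (R : realType) (M : nat) (h s : R) :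
  (0 < M)%N -> 0 <= s <= M%:R * h ->
  exists k : 'I_M, k%:R * h <= s <= k.+1%:R * h.
Proof.
case: M => // M _; elim: M => [|M IH] /andP[s0 sM].
  by exists ord0; rewrite mul0r s0.
case: (leP s (M.+1%:R * h)) => sM1.
  have [|k kP] := IH; first by rewrite s0.
  by exists (widen_ord (leqnSn _) k).
by exists ord_max; rewrite /= (ltW sM1).
Qed.

(** Cutting the cube of side [2 r] into [M ^ m] cells gives images of diameter
    at most [n.+1 * K * (2 r) / M]; the factors [M ^ m] cancel in the sum, so
    the bound does not depend on the mesh required by [hausdorff_pre]. *)
Lemma hausdorff_measure_lipschitz_le (R : realType) n m
    (phi : 'rV[R]_m -> 'rV[R]_n) (K : R) (a : 'rV[R]_m) (r : R)
    (S : set 'rV[R]_n) :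
  0 <= K -> 0 <= r -> (forall s t, `|phi s - phi t| <= K * `|s - t|) ->
  (forall x, S x -> exists2 t, `|t - a| <= r & phi t = x) ->
  (hausdorff_measure m S <=
   (hausdorff_const R m * (n.+1%:R * K * (2 * r)) ^+ m)%:E)%E.
Proof.
move=> K0 r0 phiK Sphi; apply: ge_ereal_sup => _ [d /= d0 <-].
set E := n.+1%:R * K * (2 * r).
have E0 : 0 <= E by rewrite !mulr_ge0.
pose M := (Num.Def.trunc (E / d)).+1.
have M0 : 0 < M%:R :> R by rewrite ltr0n.
have EMd : E / M%:R < d.
  by rewrite ltr_pdivrMr // mulrC -ltr_pdivrMr // truncnS_gt.
pose h := 2 * r / M%:R.
have Mh : M%:R * h = 2 * r by rewrite mulrC divfK // gt_eqF.
pose cell (f : {ffun 'I_m -> 'I_M}) := phi @`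
  [set t : 'rV[R]_m | forall j, (f j)%:R * h <= t 0 j - a 0 j + r <= (f j).+1%:R * h].
have -> : E ^+ m = #|{ffun 'I_m -> 'I_M}|%:R * (E / M%:R) ^+ m.
  rewrite card_ffun !card_ord natrX -exprMn; congr (_ ^+ _).
  by rewrite mulrC divfK // gt_eqF.
apply: (@hausdorff_pre_finite_cover _ _ _ _ S cell) => //.
- by rewrite divr_ge0.
- move=> x /Sphi[t tar <-].
  have /fin_all_exists[f fP] j : exists k : 'I_M,
      k%:R * h <= t 0 j - a 0 j + r <= k.+1%:R * h.
    apply: subdivision_cell => //; rewrite Mh.
    have := le_trans (normr_coord (t - a) 0 j) tar.
    by rewrite !mxE ler_norml => /andP[? ?]; apply/andP; split; lra.
  by exists (finfun f), t => // j; rewrite ffunE.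
- move=> f _ _ [s sf <-] [t tf <-].
  apply: le_trans (enorm_le_normr _) _.
  rewrite /E -!mulrA ler_wpM2l // (le_trans (phiK _ _)) // ler_wpM2l //.
  rewrite mulrA -/h; apply: mx_normr_le => [|i j].
    by rewrite !mulr_ge0 // invr_ge0.
  rewrite !mxE ord1; have := sf j; have := tf j.
  set b := (f j)%:R * h; have -> : (f j).+1%:R * h = b + h.
    by rewrite -natr1 mulrDl mul1r.
  move=> /andP[t1 t2] /andP[s1 s2]; by rewrite ler_norml; apply/andP; split; lra.
Qed.

(** * Positivity of the measure of the unit ball *)

(** Reducing each coordinate modulo [X] is injective on a set of grid points
    whose coordinates differ pairwise by less than [X]. *)
Lemma card_ffun_near m M X (S : {set {ffun 'I_m -> 'I_M}}) :
  (forall f g, f \in S -> g \in S -> forall j, (f j < g j + X)%N) ->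
  (#|S| <= X ^ m)%N.
Proof.
case: X => [|X] SX.
  case: m S SX => [|m] S SX.
    rewrite expn0; apply: leq_trans (max_card _) _.
    by rewrite card_ffun !card_ord.
  rewrite exp0n // leqn0 cards_eq0; apply/eqP/setP => f; rewrite inE.
  by apply/negP => fS; have := SX f f fS fS ord0; rewrite addn0 ltnn.
pose res (f : {ffun 'I_m -> 'I_M}) : {ffun 'I_m -> 'I_X.+1} :=
  [ffun j => inord (f j %% X.+1)].
rewrite -(card_in_imset (f := res)) => [|f g fS gS /ffunP fg].
  by apply: leq_trans (max_card _) _; rewrite card_ffun !card_ord.
apply/ffunP => j; apply: val_inj => /=.
have := fg j; rewrite !ffunE => /(congr1 val) /=.
rewrite !inordK ?ltn_pmod // => fgj.
have := SX f g fS gS j; have := SX g f gS fS j.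
move: (nat_of_ord (f j)) (nat_of_ord (g j)) fgj => a b ab ltab ltba.
move: (divn_eq a X.+1) (divn_eq b X.+1); rewrite ab.
move: (a %/ _)%N (b %/ _)%N (b %% _)%N => p q r ap bq.
suff pq : p = q by rewrite ap bq pq.
have: (p * X.+1 < q.+1 * X.+1)%N by lia.
have: (q * X.+1 < p.+1 * X.+1)%N by lia.
by rewrite !ltn_pmul2r // !ltnS => qp pq; apply/eqP; rewrite eqn_leq qp pq.
Qed.

(** Volume comparison without a measure. A set of sup-diameter [D i] contains at
    most [(M * D i / h + 1) ^ m] points of the grid with [M] points per side,
    and all [M ^ m] grid points must be covered; for a fine grid the additive
    [1] is at most the other term, whence the factor [2]. *)
Lemma cube_finite_cover (R : realType) m (T : eqType) (s : seq T)
    (P : T -> set 'rV[R]_m) (D : T -> R) (h : R) :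
  0 < h -> (forall i, i \in s -> 0 < D i) ->
  (forall i, i \in s -> forall x z, P i x -> P i z -> `|x - z| <= D i) ->
  (forall x : 'rV[R]_m, (forall j, 0 <= x 0 j <= h) ->
    exists2 i, i \in s & P i x) ->
  h ^+ m <= \sum_(i <- s) (2 * D i) ^+ m.
Proof.
move=> h0 D0 PD sP.
(* [M] exceeds every [h / D i], so that [M * D i / h >= 1] throughout. *)
pose M := (\sum_(i <- s) (Num.Def.trunc (h / D i)).+1).+1.
have M0 : 0 < M%:R :> R by rewrite ltr0n.
have hM0 : 0 < h / M%:R by rewrite divr_gt0.
have MD i : i \in s -> 1 <= M%:R * D i / h.
  move=> si; rewrite ler_pdivlMr // mul1r -ler_pdivrMr ?D0 //.
  apply: le_trans (ltW (truncnS_gt _)) _; rewrite ler_nat.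
  by rewrite /M (big_rem i) //= leqW // leq_addr.
pose pt (f : {ffun 'I_m -> 'I_M}) : 'rV[R]_m := \row_j ((f j)%:R * (h / M%:R)).
pose X i := (Num.Def.trunc (M%:R * D i / h)).+1.
pose S i := [set f : {ffun 'I_m -> 'I_M} | `[< P i (pt f) >]]%SET.
have SX i : i \in s -> (#|S i| <= X i ^ m)%N.
  move=> si; apply: card_ffun_near => f g.
  rewrite !finset.in_set => /asboolP Pf /asboolP Pg j.
  have := le_trans (normr_coord _ 0 j) (PD i si _ _ Pf Pg).
  rewrite !mxE -mulrBl ler_norml => /andP[_].
  rewrite -ler_pdivlMr // invf_div mulrA [_ * M%:R]mulrC => fg.
  by rewrite -(ltr_nat R) natrD -ltrBlDl (le_lt_trans fg) // truncnS_gt.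
have XD i : i \in s -> (X i)%:R <= 2 * (M%:R * D i / h).
  move=> si; have := MD i si; rewrite /X -natr1.
  have : (Num.Def.trunc (M%:R * D i / h))%:R <= M%:R * D i / h.
    by rewrite truncn_le // (le_trans _ (MD i si)).
  by lra.
have Mm : (M ^ m <= \sum_(i <- s) #|S i|)%N.
  have -> : (M ^ m = \sum_(f : {ffun 'I_m -> 'I_M}) 1)%N.
    by rewrite sum1_card card_ffun !card_ord.
  have -> : (\sum_(i <- s) #|S i| = \sum_f \sum_(i <- s) (f \in S i))%N.
    rewrite exchange_big; apply: eq_bigr => i _.
    by rewrite -sum1_card big_mkcond.
  apply: leq_sum => f _; have [j|i si Pi] := sP (pt f).
    rewrite mxE mulr_ge0 ?(ltW hM0) //= mulrCA ler_piMr ?(ltW h0) //.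
    by rewrite ler_pdivrMr // mul1r ler_nat ltnW.
  rewrite (big_rem i) //= finset.in_set.
  by case: asboolP.
have hpos : 0 <= h / M%:R by exact: ltW.
have -> : h ^+ m = (h / M%:R) ^+ m * (M ^ m)%:R.
  by rewrite natrX -exprMn divfK // gt_eqF.
apply: (@le_trans _ _ ((h / M%:R) ^+ m * (\sum_(i <- s) #|S i|)%:R)).
  by rewrite ler_wpM2l ?exprn_ge0 // ler_nat.
rewrite natr_sum mulr_sumr; rewrite big_seq [leRHS]big_seq.
apply: ler_sum => i si.
have -> : 2 * D i = h / M%:R * (2 * (M%:R * D i / h)).
  by field; rewrite !gt_eqF.
rewrite [leRHS]exprMn ler_wpM2l ?exprn_ge0 //.
apply: (@le_trans _ _ ((X i)%:R ^+ m)); first by rewrite -natrX ler_nat SX.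
by rewrite lerXn2r ?nnegrE ?XD // (le_trans _ (XD i si)).
Qed.

(** The compactness argument needs open sets: a [t]-neighbourhood of [C] has
    diameter at most [ediam C + 2 t], and [t] can be chosen so small that the
    [m]-th power increases by at most [e]. *)
Lemma diam_pow_enlarge (R : realType) n m (C : set 'rV[R]_n) (e : R) :
  0 < e -> C !=set0 -> (ediam C < +oo)%E ->
  exists t : R, [/\ 0 < t,
    forall x y x' y', C x -> C y -> `|x - x'| < t -> `|y - y'| < t ->
      `|x' - y'| <= fine (ediam C) + 2 * t &
    (((fine (ediam C) + 2 * t) ^+ m)%:E <= diam_pow m C + e%:E)%E].
Proof.
move=> e0 C0 Coo; have dge0 := ediam_ge0 C0.
have dfin : ediam C \is a fin_num by rewrite ge0_fin_numE.
rewrite /diam_pow ifF; last by apply/negbTE/set0P.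
have enorm_le x y : C x -> C y -> enorm (x - y) <= fine (ediam C).
  move=> Cx Cy; rewrite -lee_fin fineK //; apply: ereal_sup_ubound.
  by exists x => //; exists y.
move: (fineK dfin); set d := fine _ in enorm_le * => dE.
have d0 : 0 <= d by exact: fine_ge0.
have /(cvgr_lt _) /(_ (d ^+ m + e)) : x ^+ m @[x --> d] --> d ^+ m.
  exact: exprn_continuous.
rewrite ltrDl => /(_ e0) /nbhs_ballP[r /= r0 rP].
exists (r / 4); split; first by rewrite divr_gt0.
  move=> x y x' y' Cx Cy xx' yy'.
  have -> : x' - y' = (x' - x) + (x - y) + (y - y').
    by rewrite (addrA (x' - x)) subrK addrA subrK.
  apply: le_trans (ler_normD _ _) _.
  have := ler_normD (x' - x) (x - y).
  have := le_trans (normr_le_enorm _) (enorm_le x y Cx Cy).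
  move: xx' yy'; rewrite distrC; lra.
rewrite -dE -EFin_expe -EFinD lee_fin ltW //; apply: rP.
by rewrite /ball /= opprD addNKr normrN ger0_norm; lra.
Qed.

(** Enlarging the [i]-th set at a cost of [e / 2 ^ i.+1] makes the cover open;
    a finite subcover then falls under [cube_finite_cover]. *)
Lemma cube_cover_diam_pow (R : realType) m (C : nat -> set 'rV[R]_m) (h : R) :
  0 < h -> (forall i, (ediam (C i) < +oo)%E) ->
  (forall x : 'rV[R]_m, (forall j, 0 <= x 0 j <= h) -> exists i, C i x) ->
  (((h / 2) ^+ m)%:E <= \sum_(0 <= i <oo) diam_pow m (C i))%E.
Proof.
move=> h0 Coo hC; apply/lee_addgt0Pr => e e0.
apply: le_trans (epsilon_trick xpredT (fun i => diam_pow_ge0 m (C i)) (ltW e0)).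
pose a i := (diam_pow m (C i) + (e / (2 ^ i.+1)%:R)%:E)%E.
have ei i : 0 < e / (2 ^ i.+1)%:R by rewrite divr_gt0 // ltr0n expn_gt0.
have /choice[t tP] i : exists t, C i !=set0 -> [/\ 0 < t,
    forall x y x' y', C i x -> C i y -> `|x - x'| < t -> `|y - y'| < t ->
      `|x' - y'| <= fine (ediam (C i)) + 2 * t &
    (((fine (ediam (C i)) + 2 * t) ^+ m)%:E <= a i)%E].
  have [C0|C0] := pselect (C i !=set0); last by exists 0.
  by have [t tP] := diam_pow_enlarge m (ei i) C0 (Coo i); exists t.
pose O i := \bigcup_(x in C i) ball x (t i).
pose D i := fine (ediam (C i)) + 2 * t i.
(* Empty [C i] are discarded: for [m = 0] an enlarged diameter has power [1],
   whereas [diam_pow 0 set0 = 0]. *)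
have : cover_compact [set x : 'rV[R]_m | forall j, `[0, h]%classic (x 0 j)].
  rewrite -compact_cover; apply: (@rV_compact _ _ (fun=> `[0, h]%classic)).
  by move=> _; exact: segment_compact.
case/(_ _ [set i | C i !=set0] O) => [i _|x hx|s sC hs].
- by apply: bigcup_open => x _; exact: ball_open.
- have [|i Cix] := hC x; first by move=> j; have := hx j; rewrite /= in_itv.
  exists i; first by exists x.
  have [|t0 _ _] := tP i; first by exists x.
  by exists x => //; exact: ballxx.
have {}sC i : i \in s -> C i !=set0 by move=> /sC /set_mem.
have tgt0 i : i \in s -> 0 < t i by move=> /sC /tP[].
have d0 i : i \in s -> 0 <= fine (ediam (C i)).
  by move=> /sC C0; rewrite fine_ge0 // ediam_ge0.
have : h ^+ m <= \sum_(i <- s) (2 * D i) ^+ m.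
  apply: (cube_finite_cover (P := O) h0) => [i si|i si x z|x hx].
  - by rewrite ltr_wpDl ?d0 // mulr_gt0 // tgt0.
  - case: (tP i (sC _ si)) => _ tD _ [x' Cx' /= xx'] [z' Cz' /= zz'].
    apply: tD Cx' Cz' _ _.
      by move: xx'; rewrite -ball_normE.
    by move: zz'; rewrite -ball_normE.
  - have [|i si Oi] := hs x; last by exists i.
    by move=> j; rewrite /= in_itv; exact: hx.
have -> : h ^+ m = 2 ^+ m * (h / 2) ^+ m.
  by rewrite -exprMn mulrC divfK.
under eq_bigr do rewrite exprMn.
rewrite -mulr_sumr ler_pM2l ?exprn_gt0 // -lee_fin => /le_trans; apply.
rewrite nneseries_esumT => [|i]; last first.
  by rewrite adde_ge0 ?diam_pow_ge0 // lee_fin ltW.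
apply: esum_ge; exists [set` s]; first by split.
rewrite -fsbig_seq // -sumEFin big_seq [leRHS]big_seq.
by apply: lee_sum => i /sC /tP[].
Qed.

(** The unit ball contains a cube of side [1 / (2 m.+1)]. *)
Lemma omega_gt0 (R : realType) m : (0 < omega R m)%E.
Proof.
pose h : R := (2 * m.+1%:R)^-1.
have h0 : 0 < h by rewrite invr_gt0 mulr_gt0.
apply: (@lt_le_trans _ _ (hausdorff_const R m * (h / 2) ^+ m)%:E).
  by rewrite lte_fin mulr_gt0 ?hausdorff_const_gt0 // exprn_gt0 // divr_gt0.
apply: (@le_trans _ _ (hausdorff_pre m 1 (eball (0 : 'rV[R]_m) 1))); last first.
  by apply: ereal_sup_ubound; exists 1 => /=.
rewrite EFinM; apply: lee_wpmul2l; first by rewrite lee_fin ltW ?hausdorff_const_gt0.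
apply: le_ereal_inf_tmp => _ [C [CB Cd] <-].
apply: cube_cover_diam_pow => // [i|x hx].
  by apply: lt_trans (Cd i) _; rewrite ltry.
have [|i _ Cix] := CB x; last by exists i.
rewrite /eball /= subr0 (le_lt_trans (enorm_le_normr _)) //.
apply: (@le_lt_trans _ _ (m.+1%:R * h)).
  rewrite ler_wpM2l //; apply: mx_normr_le; first exact: ltW.
  by move=> i j; rewrite ord1; have /andP[? ?] := hx j; rewrite ger0_norm.
rewrite /h invfM mulrCA divff ?mulr1 ?invf_lt1 //.
by rewrite ltr1n.
Qed.

(** * Flatness confines the set to the graph *)

(** If an [m]-dimensional [V] nearly contains vectors [p i] that [Q] maps to
    [d e_i], then the nearby [v i] form a basis of [V] on which [Q] is close to
    [d] times the identity, hence [Q] is injective on [V] with a quantitative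
    inverse. A vector of [V] close to the kernel of [Q] must therefore be
    small. *)
Lemma transversal_plane_bound (R : realType) n m (V : {vspace 'rV[R]_n})
    (Q : 'M[R]_(n, m)) (p v : 'I_m -> 'rV[R]_n) (p0 v0 : 'rV[R]_n)
    (K q e d : R) :
  \dim V = m -> 0 < d -> 0 <= K -> 0 <= q -> 0 <= e -> e <= 1 ->
  2 * m%:R * q * e <= 1 ->
  (forall x : 'rV[R]_n, `|x *m Q| <= q * `|x|) ->
  (forall i, p i *m Q = d *: delta_mx 0 i) -> (forall i, `|p i| <= K * d) ->
  p0 *m Q = 0 ->
  (forall i, v i \in V) -> v0 \in V ->
  (forall i, `|v i - p i| <= e * d) -> `|v0 - p0| <= e * d ->
  `|p0| <= (2 * m%:R * q * e * (K + 1) + e) * d.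
Proof.
move=> dimV d0 K0 q0 e0 e1 mqe Qq pQ pK p0Q vV v0V vp v0p0.
pose W := \matrix_i v i; pose E := W *m Q - d%:M.
have qe0 : 0 <= q * (e * d) by rewrite !mulr_ge0 // ltW.
have El : `|E| <= q * (e * d).
  apply: mx_normr_le => // i j.
  have -> : E i j = ((v i - p i) *m Q) 0 j.
    rewrite mulmxBl pQ !mxE eqxx /= eq_sym mulr_natr; congr (_ - _).
    by apply: eq_bigr => k _; rewrite mxE.
  apply: le_trans (normr_coord _ _ _) _; apply: le_trans (Qq _) _.
  by rewrite ler_wpM2l.
have Wl : `|W| <= (K + 1) * d.
  apply: mx_normr_le => [|i j]; first by rewrite mulr_ge0 ?addr_ge0 // ltW.
  rewrite mxE (le_trans (normr_coord _ _ _)) // -(subrK (p i) (v i)).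
  apply: le_trans (ler_normD _ _) _.
  rewrite mulrDl mul1r addrC lerD ?pK // (le_trans (vp i)) //.
  by rewrite ler_piMl // ltW.
(* [W *m Q] is a perturbation of [d%:M] of relative size at most [1 / 2]. *)
have inj (a : 'rV[R]_m) : d * `|a| <= 2 * `|a *m W *m Q|.
  have -> : a *m W *m Q = d *: a + a *m E.
    by rewrite mulmxBr mul_mx_scalar mulmxA addrC subrK.
  have aE : `|a *m E| <= 2^-1 * (d * `|a|).
    apply: le_trans (normr_mulmx _ _) _.
    apply: (@le_trans _ _ (m%:R * `|a| * (q * (e * d)))).
      by rewrite ler_wpM2l // mulr_ge0.
    have -> : m%:R * `|a| * (q * (e * d)) =
       2^-1 * (2 * m%:R * q * e * (d * `|a|)) by field.
    by rewrite ler_wpM2l // ler_piMl // mulr_ge0 // ltW.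
  have := ler_normB (d *: a + a *m E) (a *m E).
  by rewrite addrK normrZ gtr0_norm //; lra.
have WX (k : 'I_m -> R) : (\row_i k i) *m W = \sum_(i < m) k i *: v i.
  rewrite mulmx_sum_row; apply: eq_bigr => i _.
  by rewrite mxE; congr (_ *: _); apply/rowP => j; rewrite !mxE.
pose X := [tuple v i | i < m].
have vX (i : 'I_m) : X`_i = v i by rewrite -tnth_nth tnth_mktuple.
have freeX : free X.
  apply/freeP => k; under eq_bigr do rewrite vX; rewrite -WX => kX i.
  have := inj (\row_i k i); rewrite kX mul0mx normr0 mulr0.
  rewrite pmulr_rle0 // normr_le0 => /eqP/rowP/(_ i).
  by rewrite !mxE.
have basisX : basis_of V X.
  rewrite basisEfree freeX size_tuple dimV leqnn andbT.
  apply/span_subvP => _ /tnthP[i ->]; rewrite tnth_mktuple; exact: vV.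
pose a : 'rV[R]_m := \row_i coord X i v0.
have v0E : v0 = a *m W.
  rewrite WX [LHS](coord_basis basisX v0V).
  by apply: eq_bigr => i _; rewrite vX.
have al : `|a| <= 2 * q * e.
  rewrite -(ler_pM2l d0); apply: le_trans (inj a) _.
  rewrite -v0E -(subrK p0 v0) mulmxDl p0Q addr0.
  have -> : d * (2 * q * e) = 2 * (q * (e * d)) by ring.
  by rewrite ler_wpM2l // (le_trans (Qq _)) // ler_wpM2l.
have v0l : `|v0| <= 2 * m%:R * q * e * (K + 1) * d.
  rewrite v0E; apply: le_trans (normr_mulmx _ _) _.
  have -> : 2 * m%:R * q * e * (K + 1) * d =
    m%:R * (2 * q * e) * ((K + 1) * d) by ring.
  by rewrite ler_pM ?mulr_ge0 // ler_wpM2l.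
have := ler_normB v0 (v0 - p0); rewrite opprB addrC subrK mulrDl.
by move: v0l v0p0; lra.
Qed.

Lemma tube_near (R : realType) n (x : 'rV[R]_n) (V : {vspace 'rV[R]_n})
    (w : 'rV[R]_n) (r : R) :
  tube [set g + x | g in [set g | g \in V]] r w ->
  exists2 v, v \in V & `|v - (w - x)| < r.
Proof.
case/inf_lt => [|_ [_ [v Vv <-] <-] wr].
  by exists (enorm (w - (0 + x))), (0 + x) => //; exists 0; rewrite //= mem0v.
exists v => //; apply: le_lt_trans wr; apply: le_trans (normr_le_enorm _).
by rewrite -normrN opprB opprD addrA addrAC.
Qed.

(** Flatness of [A] at a scale comparable to the distance from [z] to the graph
    is incompatible with a plane that follows the graph and also comes close to
    a point vertically off it. *)
Lemma flat_set_in_graph (R : realType) n m (A : set 'rV[R]_n) (y : 'rV[R]_n)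
    (phi : 'rV[R]_m -> 'rV[R]_n) (Q : 'M[R]_(n, m)) (K rho1 : R) :
  R_w_rho_delta m A -> A y -> 0 < rho1 -> 0 <= K ->
  (forall s t, `|phi s - phi t| <= K * `|s - t|) ->
  (forall t, phi t *m Q = t) -> phi (y *m Q) = y ->
  (forall t, eball y rho1 (phi t) -> forall e : R, 0 < e ->
    exists2 x, A x & `|x - phi t| < e) ->
  exists2 r : R, 0 < r &
    forall z, A z -> `|z - y| < r -> phi (z *m Q) = z.
Proof.
move=> Aflat Ay rho10 K0 phiK phiQ phiy phiA.
pose N : R := n.+1%:R; pose q := n%:R * `|Q|.
have N0 : 0 < N by rewrite ltr0n.
have q0 : 0 <= q by rewrite mulr_ge0.
have Qq (x : 'rV[R]_n) : `|x *m Q| <= q * `|x|.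
  by rewrite (le_trans (normr_mulmx _ _)) // mulrAC.
(* [3 * e] is the relative error with which the plane contains the vectors
   below; it is chosen so that the bound of [transversal_plane_bound] is
   [3 * e * (b + 1) < 1]. *)
pose b := 2 * m%:R * q * (K + 1).
have b0 : 0 <= b by rewrite !mulr_ge0 // addr_ge0.
pose e := (b + 2)^-1 / 3.
have e0 : 0 < e by rewrite divr_gt0 // invr_gt0; lra.
have eb : 3 * e * (b + 2) = 1 by rewrite /e; field; lra.
have e1 : 3 * e <= 1.
  by have := mulr_ge0 (ltW e0) b0; lra.
have c0 : 0 < N * (K + 3) by rewrite mulr_gt0 //; lra.
have c1 : 1 <= N * (K + 3).
  by rewrite mulr_ege1 ?ler1n //; lra.
(* At the scale [rho = N * (K + 3) * d] used below, [g * rho = e * d]. *)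
pose g := e / (N * (K + 3)).
have g0 : 0 < g by rewrite divr_gt0.
have g1 : g < 1.
  by rewrite ltr_pdivrMr // mul1r; lra.
have [rhoy rhoy0 HA] := Aflat g g0 g1 y Ay.
pose k := 1 + K * q.
have k1 : 1 <= k by rewrite lerDl mulr_ge0.
pose mu := Num.min rho1 rhoy.
have mu0 : 0 < mu by rewrite lt_min rho10.
exists (mu / (N * (K + 3) * k)) => [|z Az].
  by rewrite divr_gt0 // mulr_gt0 //; lra.
rewrite ltr_pdivlMr; last by rewrite mulr_gt0 //; lra.
move=> zy; apply/eqP/negPn/negP => /eqP phiz.
set t := z *m Q in phiz *.
pose d := `|z - phi t|; pose s := k * `|z - y|.
have d0 : 0 < d.
  by rewrite normr_gt0 subr_eq0; apply/eqP => zt; apply: phiz.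
have phity : `|phi t - y| <= K * q * `|z - y|.
  rewrite -{1}phiy (le_trans (phiK _ _)) // -mulrA ler_wpM2l //.
  by rewrite /t -mulmxBl.
have ty_s : `|phi t - y| <= s.
  by apply: le_trans phity _; rewrite ler_wpM2r // /k; lra.
have ds : d <= s.
  apply: (@le_trans _ _ (`|z - y| + `|phi t - y|)).
    by have := ler_normB (z - y) (phi t - y); rewrite opprB addrA subrK.
  by rewrite /s /k mulrDl mul1r lerD2l.
have small (w : 'rV[R]_n) : `|w| <= (K + 3) * s -> enorm w < mu.
  move=> ws; apply: le_lt_trans (enorm_le_normr _) _; apply: le_lt_trans zy.
  have -> : `|z - y| * (N * (K + 3) * k) = N * ((K + 3) * s).
    by rewrite /s; ring.
  by rewrite ler_wpM2l // ltW.
have Ks : K * d <= K * s by rewrite ler_wpM2l.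
have Ks0 : 0 <= K * s by rewrite mulr_ge0 // (le_trans _ ds) // ltW.
have ed0 : 0 < e * d by rewrite mulr_gt0.
have ed : e * d <= d by rewrite ler_piMl; lra.
(* [phi] moves by at most [K * d] from [t] to [tt i], so all sample points of
   [A] stay within [(K + 2) * d] of [x]. *)
pose tt i := t + d *: delta_mx 0 i.
have phitt i : `|phi (tt i) - phi t| <= K * d.
  rewrite (le_trans (phiK _ _)) // ler_wpM2l // /tt addrC addKr.
  rewrite normrZ gtr0_norm //; apply: ler_piMr; first exact: ltW.
  apply: mx_normr_le => // u v.
  by rewrite mxE; case: (_ && _); rewrite ?normr1 ?normr0.
have [x Ax xt] : exists2 x, A x & `|x - phi t| < e * d.
  apply: phiA => //.
  have : enorm (phi t - y) < mu by apply: small; lra.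
  by rewrite lt_min => /andP[].
have /fin_all_exists2[xx Axx xxt] i :
    exists2 x, A x & `|x - phi (tt i)| < e * d.
  apply: phiA => //.
  have : enorm (phi (tt i) - y) < mu.
    apply: small; rewrite -(subrK (phi t) (phi (tt i))) -addrA.
    by have := ler_normD (phi (tt i) - phi t) (phi t - y); have := phitt i; lra.
  by rewrite lt_min => /andP[].
have xy : enorm (x - y) < rhoy.
  have : enorm (x - y) < mu.
    apply: small; rewrite -(subrK (phi t) x) -addrA.
    by have := ler_normD (x - phi t) (phi t - y); lra.
  by rewrite lt_min => /andP[].
pose rho := N * (K + 3) * d.
have rho0 : 0 < rho by rewrite mulr_gt0.
have rho_le : rho <= rhoy.
  apply: (@le_trans _ _ mu); last by rewrite ge_min lexx orbT.
  apply: le_trans (ltW zy); have -> : `|z - y| * (N * (K + 3) * k) = N * (K + 3) * s.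
    by rewrite /s; ring.
  by rewrite ler_wpM2l // ltW.
have [L [V dimV <-] AL] := HA rho rho0 rho_le x (conj xy Ax).
have grho : g * rho = e * d by rewrite /g /rho mulrA divfK // gt_eqF.
have near_plane w : A w -> `|w - x| <= (K + 2) * d ->
    exists2 v, v \in V & `|v - (w - x)| < e * d.
  move=> Aw wx; apply: tube_near; rewrite -grho; apply: AL; split => //.
  apply: le_lt_trans (enorm_le_normr _) _.
  by rewrite /rho -mulrA ltr_pM2l // (le_lt_trans wx) // ltr_pM2r //; lra.
have [v0 v0V v0z] : exists2 v, v \in V & `|v - (z - x)| < e * d.
  apply: near_plane => //; rewrite -(subrK (phi t) z) -addrA.
  have := ler_normB (z - phi t) (x - phi t); rewrite opprB -/d.
  have : 0 <= K * d by rewrite mulr_ge0 // ltW.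
  by lra.
have /fin_all_exists2[v vV vx] i :
    exists2 v, v \in V & `|v - (xx i - x)| < e * d.
  apply: near_plane => //.
  have -> : xx i - x = (xx i - phi (tt i)) + (phi (tt i) - phi t) - (x - phi t).
    by rewrite opprB !addrA !subrK.
  have := ler_normB (xx i - phi (tt i) + (phi (tt i) - phi t)) (x - phi t).
  have := ler_normD (xx i - phi (tt i)) (phi (tt i) - phi t).
  by have := phitt i; have := xxt i; lra.
have := @transversal_plane_bound R n m V Q (fun i => phi (tt i) - phi t) v
  (z - phi t) v0 K q (3 * e) d dimV d0 K0 q0.
rewrite -/d => /(_ _ e1 _ Qq _ phitt) bound.
suff : d <= (b * (3 * e) + 3 * e) * d by rewrite -subr_ge0; nra.
have -> : b * (3 * e) = 2 * m%:R * q * (3 * e) * (K + 1) by rewrite /b; ring.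
apply: bound => //.
- by lra.
- have : 2 * m%:R * q <= b.
    by rewrite /b ler_peMr ?mulr_ge0 //; lra.
  by nra.
- by move=> i; rewrite mulmxBl !phiQ /tt addrC addKr.
- by rewrite mulmxBl phiQ subrr.
- move=> i.
  have -> : v i - (phi (tt i) - phi t) =
      (v i - (xx i - x)) + (xx i - phi (tt i)) - (x - phi t).
    by apply/rowP => j; rewrite !mxE; ring.
  have := ler_normB (v i - (xx i - x) + (xx i - phi (tt i))) (x - phi t).
  have := ler_normD (v i - (xx i - x)) (xx i - phi (tt i)).
  by have := vx i; have := xxt i; lra.
- have -> : v0 - (z - phi t) = (v0 - (z - x)) - (x - phi t).
    by apply/rowP => j; rewrite !mxE; ring.
  by have := ler_normB (v0 - (z - x)) (x - phi t); lra.
Qed.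

(** * Graph charts and densities *)

Lemma dot_eq0 (R : realType) n (x : 'rV[R]_n) : dot x x = 0 -> x = 0.
Proof.
move=> x0; apply/eqP; rewrite -normr_le0.
by apply: le_trans (normr_le_enorm x) _; rewrite /enorm x0 sqrtr0.
Qed.

(** With [B] the matrix of a basis of [G], the orthogonal projection onto [G] is
    [Q *m B] for [Q = B^T (B B^T)^-1]; the Gram matrix is invertible because
    [dot] is definite. *)
Lemma vspace_basis_coord (R : realType) n (G : {vspace 'rV[R]_n}) :
  exists (B : 'M[R]_(\dim G, n)) (Q : 'M[R]_(n, \dim G)),
  [/\ forall x, x \in G <-> exists t, x = t *m B, B *m Q = 1%:M &
    forall w, orthocompl G w -> w *m Q = 0].
Proof.
pose B : 'M[R]_(\dim G, n) := \matrix_i (vbasis G)`_i.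
have BE (t : 'rV[R]_(\dim G)) : t *m B = \sum_i t 0 i *: (vbasis G)`_i.
  rewrite mulmx_sum_row; apply: eq_bigr => i _; congr (_ *: _).
  by apply/rowP => j; rewrite !mxE.
have BG x : x \in G <-> exists t, x = t *m B.
  split => [xG|[t ->]].
    exists (\row_i coord (vbasis G) i x); rewrite BE [LHS](coord_vbasis xG).
    by apply: eq_bigr => i _; rewrite mxE.
  rewrite BE; apply: memv_suml => i _; rewrite memvZ // vbasis_mem //.
  by rewrite mem_nth // size_tuple.
have Bfree (t : 'rV[R]_(\dim G)) : t *m B = 0 -> t = 0.
  rewrite BE => t0; apply/rowP => i; rewrite mxE.
  by have /freeP/(_ (fun i => t 0 i) t0 i) := basis_free (vbasisP G).
have gram : B *m B^T \in unitmx.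
  rewrite -row_free_unit; apply/inj_row_free => v vB.
  by apply/Bfree/dot_eq0; rewrite /dot trmx_mul mulmxA -(mulmxA v) vB mul0mx mxE.
exists B, (B^T *m invmx (B *m B^T)); split => //.
  by rewrite mulmxA mulmxV.
move=> w wG; rewrite mulmxA (_ : w *m B^T = 0) ?mul0mx //.
apply/rowP => i; rewrite [RHS]mxE -(wG (row i B)); last first.
  by apply/BG; exists (delta_mx 0 i); rewrite -rowE.
by rewrite /dot !mxE; apply: eq_bigr => j _; rewrite !mxE mulrC.
Qed.

(** Parametrizing by R^m instead of [G], with the coordinates recovered linearly
    by [Q], is all that the rest of the proof uses about the graph. *)
Lemma graph_chart (R : realType) n (G : {vspace 'rV[R]_n})
    (u : 'rV[R]_n -> 'rV[R]_n) : lipschitz_to_perp G u ->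
  exists (phi : 'rV[R]_(\dim G) -> 'rV[R]_n) (Q : 'M[R]_(n, \dim G)) (K : R),
  [/\ 0 <= K, forall s t, `|phi s - phi t| <= K * `|s - t|,
    forall t, phi t *m Q = t & graph_over G u = range phi].
Proof.
move=> [uG [c uc]]; have [B [Q [BG BQ Q0]]] := vspace_basis_coord G.
have tG t : t *m B \in G by apply/BG; exists t.
pose k := (\dim G)%:R * `|B|; have k0 : 0 <= k by rewrite mulr_ge0.
exists (fun t => t *m B + u (t *m B)), Q, ((1 + `|c| * n.+1%:R) * k); split.
- by rewrite mulr_ge0 // addr_ge0 // mulr_ge0.
- move=> s t; rewrite opprD addrACA.
  apply: le_trans (ler_normD _ _) _.
  have st : `|s *m B - t *m B| <= k * `|s - t|.
    by rewrite -mulmxBl (le_trans (normr_mulmx _ _)) // mulrAC.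
  rewrite -mulrA mulrDl mul1r lerD // -mulrA.
  apply: le_trans (normr_le_enorm _) _; apply: le_trans (uc _ _ (tG s) (tG t)) _.
  apply: (@le_trans _ _ (`|c| * enorm (s *m B - t *m B))).
    by rewrite ler_wpM2r ?enorm_ge0 // ler_norm.
  rewrite ler_wpM2l // (le_trans (enorm_le_normr _)) // ler_wpM2l //.
- by move=> t; rewrite mulmxDl -mulmxA BQ mulmx1 Q0 ?addr0 //; exact: uG.
- apply/seteqP; split => [_ [x /BG[t ->] <-]|_ [t _ <-]]; first by exists t.
  by exists (t *m B) => //; exact: tG.
Qed.

(** Positivity of [omega] matters since the inverse of [0] is [+oo]. *)
Lemma lower_density_lty (R : realType) n m (A : set 'rV[R]_n) (y : 'rV[R]_n)
    (c r : R) : 0 < r -> 0 <= c ->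
  (forall rho, 0 < rho -> rho < r ->
    (hausdorff_measure m (A `&` eball y rho) <= (c * rho ^+ m)%:E)%E) ->
  (lower_density m A y < +oo)%E.
Proof.
move=> r0 c0 Hc; have om0 := omega_gt0 R m.
have [b Hb] : exists b : R, forall rho, 0 < rho -> rho < r ->
    (hausdorff_measure m (A `&` eball y rho) / (omega R m * (rho ^+ m)%:E)
       <= b%:E)%E.
  case: (omega R m) om0 => [w||] // w0.
    exists (c / w) => rho rho0 rhor; have rm0 : 0 < rho ^+ m by rewrite exprn_gt0.
    have wrm0 : 0 < w * rho ^+ m by rewrite mulr_gt0.
    rewrite -EFinM inver gt_eqF //.
    apply: le_trans (lee_wpmul2r _ (Hc rho rho0 rhor)) _.
      by rewrite lee_fin invr_ge0 ltW.
    rewrite -EFinM lee_fin; rewrite le_eqVlt; apply/orP; left; apply/eqP.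
    by field; rewrite !gt_eqF.
  (* An infinite [omega] makes the quotient vanish. *)
  exists 0 => rho rho0 rhor.
  by rewrite gt0_mulye ?invey ?mule0 // lte_fin exprn_gt0.
apply: le_lt_trans (ltry b); rewrite /lower_density limf_einfE.
apply: ge_ereal_sup => _ [V V0 <-].
have [rho [Vrho /andP[rho0 rhor]]] :
    exists rho, V rho /\ (0 < rho < r).
  have rnear : \forall x \near (0 : R)^'+, 0 < x < r.
    near=> x; apply/andP; split; first by [].
    by near: x; exact: nbhs_right_lt.
  by have [x []] := filter_ex (filterI V0 rnear); exists x.
apply: le_trans (Hb _ rho0 rhor); apply: ereal_inf_lbound.
by exists rho.
Unshelve. all: by end_near. Qed.

(** * Infinite density excludes flatness *)

Unset Implicit Arguments.
Set Strict Implicit.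

Theorem theorem6p2 (R : realType) (n m : nat) (hmn : (m <= n)%N)
    (A : set 'rV[R]_n) (y : 'rV[R]_n) (hy : A y)
    (rho1 : R) (hrho1 : 0 < rho1)
    (G : {vspace 'rV[R]_n}) (hG : grassmannian m G)
    (u : 'rV[R]_n -> 'rV[R]_n) (hu : lipschitz_to_perp G u)
    (hdens : lower_density m A y = +oo%E)
    (hyU : graph_over G u y)
    (hclos : closure (eball y rho1 `&` A `&` graph_over G u) =
             graph_over G u `&` closure (eball y rho1)) :
  ~ R_w_rho_delta m A.
Proof.
move=> Aflat; move: hG; rewrite /grassmannian /= => hG; subst m.
have [phi [Q [K [K0 phiK phiQ graphE]]]] := graph_chart hu.
rewrite graphE in hyU hclos.
have phiy : phi (y *m Q) = y by case: hyU => t _ <-; rewrite phiQ.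
have phiA t : eball y rho1 (phi t) -> forall e : R, 0 < e ->
    exists2 x, A x & `|x - phi t| < e.
  move=> yt e e0.
  have : closure (eball y rho1 `&` A `&` range phi) (phi t).
    by rewrite hclos; split; [exists t|exact: subset_closure].
  move=> /(_ (ball (phi t) e)) []; first exact: nbhsx_ballx.
  move=> x [[[_ Ax] _]]; rewrite -ball_normE /= distrC => xt.
  by exists x.
have [r r0 Ar] := flat_set_in_graph Aflat hy hrho1 K0 phiK phiQ phiy phiA.
pose q := n%:R * `|Q|.
have q0 : 0 <= q by rewrite mulr_ge0.
suff : (lower_density (\dim G) A y < +oo)%E by rewrite hdens ltxx.
pose c := hausdorff_const R (\dim G) * (n.+1%:R * K * (2 * q)) ^+ \dim G.
apply: (@lower_density_lty _ _ _ _ _ c r) => // [|rho rho0 rhor].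
  by rewrite mulr_ge0 ?(ltW (hausdorff_const_gt0 _ _)) // exprn_ge0 // !mulr_ge0.
have -> : c * rho ^+ \dim G =
    hausdorff_const R (\dim G) * (n.+1%:R * K * (2 * (q * rho))) ^+ \dim G.
  by rewrite /c -mulrA -exprMn; congr (_ * _ ^+ _); ring.
apply: (@hausdorff_measure_lipschitz_le _ _ _ phi K (y *m Q) (q * rho)) => //.
  by rewrite mulr_ge0 // ltW.
move=> x [Ax xy]; have xy' : `|x - y| < rho.
  exact: le_lt_trans (normr_le_enorm _) xy.
exists (x *m Q); last by apply: Ar => //; exact: lt_trans xy' rhor.
rewrite -mulmxBl (le_trans (normr_mulmx _ _)) // mulrAC ler_wpM2l //.
exact: ltW.
Qed.
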